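(* Let $P(x)=\sqrt{1-10x+9x^2}$. Then, as formal power series in $x$ whose coefficients are Laurent polynomials in $y$ (rational functions being expanded in powers of $x$), $$\sum_{n\ge0}\sum_{m\in\mathbb{Z}}A^{H}_{R}(n,m)x^ny^m=\frac{y^2}{y^2-x(1+y+y^2)^2},\qquad \sum_{n\ge0}\sum_{m\in\mathbb{Z}}A^{H}(n,m)x^ny^m=\frac{y(1+y+y^2)}{y^2-x(1+y+y^2)^2},$$ $$\sum_{n\ge0}A^{H}_{R}(n,0)x^n=\frac{1}{P(x)}\sqrt{\frac{1-3x+P(x)}{2}},\qquad \sum_{n\ge0}A^{H}(n,0)x^n=\frac{1}{P(x)}\sqrt{\frac{1-3x-P(x)}{2x}}.$$
   Context: A lattice path is a finite sequence of steps (vectors in $\mathbb{Z}^2$) starting at $(0,0)$; its vertices are the partial sums, and it terminates at the last vertex (the empty path terminates at $(0,0)$). Let $S_{M}=\{(1,0),(1,1),(1,-1)\}$ and $S_{MW}=S_M\cup\{(0,1),(0,-1)\}$; $(0,\pm1)$ are vertical steps. A vertically constrained $S_{MW}$ path is a lattice path with steps in $S_{MW}$ with no two consecutive vertical steps. $A^{H}(n,m)$ is the number of vertically constrained $S_{MW}$ paths from $(0,0)$ to $(n,m)$, and $A^{H}_{R}(n,m)$ is the number of those whose first step (if any) lies in $S_M$. *)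

(* Defs.v *)
From HB Require Import structures.
From mathcomp Require Import all_boot all_order all_algebra finmap.
From mathcomp Require Import all_classical zify ring lra.

Set Implicit Arguments.
Unset Strict Implicit.
Unset Printing Implicit Defensive.

Import Order.TTheory GRing.Theory Num.Theory.

Local Open Scope classical_set_scope.
Local Open Scope ring_scope.

Record fps (R : Type) := Fps { fps_coef :> nat -> R }.

Section FpsRing.
Variable R : comNzRingType.
Implicit Types f g h : fps R.

Lemma fpsP f g : f =1 g -> f = g.
Proof. by case: f; case: g => f g /= /funext ->. Qed.

HB.instance Definition _ := gen_eqMixin (fps R).
HB.instance Definition _ := gen_choiceMixin (fps R).

Definition fps_add f g := Fps (fun n => f n + g n).
Definition fps_opp f := Fps (fun n => - f n).
Definition fps_mul f g := Fps (fun n => \sum_(i < n.+1) f i * g (n - i)%N).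

Definition fpsC (c : R) := Fps (fun n => if n == 0%N then c else 0).
Definition fpsX : fps R := Fps (fun n => (n == 1%N)%:R).

Fact fps_addA : associative fps_add.
Proof. by move=> f g h; apply: fpsP => n /=; rewrite addrA. Qed.
Fact fps_addC : commutative fps_add.
Proof. by move=> f g; apply: fpsP => n /=; rewrite addrC. Qed.
Fact fps_add0 : left_id (fpsC 0) fps_add.
Proof. by move=> f; apply: fpsP => n /=; case: ifP; rewrite add0r. Qed.
Fact fps_addN : left_inverse (fpsC 0) fps_opp fps_add.
Proof. by move=> f; apply: fpsP => n /=; case: ifP; rewrite addNr. Qed.

HB.instance Definition _ := GRing.isZmodule.Build (fps R)
  fps_addA fps_addC fps_add0 fps_addN.

Let trunc N f : {poly R} := \poly_(i < N) f i.

Let truncM N f g n : (n < N)%N -> fps_mul f g n = (trunc N f * trunc N g)`_n.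
Proof.
move=> nN; rewrite coefM /=; apply: eq_bigr => i _; rewrite !coef_poly.
by rewrite !(leq_ltn_trans _ nN) ?leq_subr // -ltnS.
Qed.

Fact fps_mulC : commutative fps_mul.
Proof. by move=> f g; apply: fpsP => n; rewrite !(truncM _ _ (ltnSn n)) mulrC. Qed.

Fact fps_mulA : associative fps_mul.
Proof.
move=> f g h; apply: fpsP => n; set N := n.+1.
have E f1 f2 : (\sum_(i < n.+1) f1 i * fps_mul f2 h (n - i)%N)
   = (trunc N f1 * (trunc N f2 * trunc N h))`_n.
  rewrite coefM; apply: eq_bigr => i _.
  by rewrite (@truncM N) ?ltnS ?leq_subr // coef_poly ltn_ord.
rewrite [LHS]E mulrA coefM; apply: eq_bigr => i _.
by rewrite -(truncM f g (ltn_ord i)) coef_poly ltnS leq_subr.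
Qed.

Fact fps_mul1 : left_id (fpsC 1) fps_mul.
Proof.
move=> f; apply: fpsP => n /=; rewrite big_ord_recl /= mul1r subn0.
by rewrite big1 ?addr0 // => i _; rewrite mul0r.
Qed.

Fact fps_mulDl : left_distributive fps_mul fps_add.
Proof.
move=> f g h; apply: fpsP => n /=; rewrite -big_split /=.
by apply: eq_bigr => i _; rewrite mulrDl.
Qed.

Fact fps_1neq0 : fpsC 1 != 0.
Proof.
by apply/eqP => /(congr1 (fun f : fps R => f 0%N)) /= /eqP; rewrite oner_eq0.
Qed.

HB.instance Definition _ := GRing.Zmodule_isComNzRing.Build (fps R)
  fps_mulA fps_mulC fps_mul1 fps_mulDl fps_1neq0.

Definition fps_unit : {pred fps R} := fun f => `[< exists g, g * f = 1 >].
(* the inverse in the ring of formal power series; junk (f itself) when f is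
   not invertible *)
Definition fps_inv f : fps R := xget f [set g | g * f = 1].

Fact fps_mulVx : {in fps_unit, left_inverse 1 fps_inv *%R}.
Proof.
by move=> f /asboolP[g fg]; rewrite /fps_inv; case: xgetP => [//|/(_ g) []].
Qed.
Fact fps_unitPl f g : g * f = 1 -> fps_unit f.
Proof. by move=> gf; apply/asboolP; exists g. Qed.
Fact fps_inv_out : {in [predC fps_unit], fps_inv =1 id}.
Proof.
move=> f /asboolP Nf; rewrite /fps_inv; case: xgetP => // g _ gf.
by case: Nf; exists g.
Qed.

HB.instance Definition _ := GRing.ComNzRing_hasMulInverse.Build (fps R)
  fps_mulVx fps_unitPl fps_inv_out.

Lemma fps_coef0 n : (0 : fps R) n = 0.
Proof. by rewrite /= if_same. Qed.
Lemma fps_coef1 n : (1 : fps R) n = (n == 0%N)%:R.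
Proof. by rewrite /=; case: eqP. Qed.
Lemma fps_coefD f g n : (f + g) n = f n + g n.
Proof. by []. Qed.
Lemma fps_coefN f n : (- f) n = - f n.
Proof. by []. Qed.
Lemma fps_coefM f g n : (f * g) n = \sum_(i < n.+1) f i * g (n - i)%N.
Proof. by []. Qed.
Lemma fps_coef0M f g : (f * g) 0%N = f 0%N * g 0%N.
Proof. by rewrite fps_coefM big_ord1. Qed.

Lemma fps_coefXM f n : (fpsX * f) n = if n is k.+1 then f k else 0.
Proof.
rewrite fps_coefM big_ord_recl /= mul0r add0r; case: n => [|n].
  by rewrite big_ord0.
rewrite big_ord_recl /= mul1r subn1 big1 ?addr0 // => i _.
by rewrite /= mul0r.
Qed.

(* f / x, for f with zero constant term *)
Definition fps_divX f : fps R := Fps (fun n => f n.+1).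

Lemma fps_divXK f : f 0%N = 0 -> fpsX * fps_divX f = f.
Proof. by move=> f0; apply: fpsP => -[|n]; rewrite fps_coefXM. Qed.

(* the square root of f with constant term 1, for f with constant term 1 *)
Definition fps_sqrt f : fps R :=
  xget 0 [set g : fps R | g 0%N = 1 /\ g ^+ 2 = f].

End FpsRing.

Arguments fpsX {R}.

Section FpsUnitSqrt.
Variable R : comUnitRingType.
Implicit Types f g : fps R.

Let fps_rec (step : nat -> (nat -> R) -> R) :
  (forall n u v, (forall i, (i < n)%N -> u i = v i) -> step n u = step n v) ->
  exists u : nat -> R, forall n, u n = step n u.
Proof.
move=> stepE.
pose W := fix W n := if n is k.+1 then rcons (W k) (step k (nth 0 (W k)))
  else [::] : seq R.
have sW n : size (W n) = n by elim: n => //= n IH; rewrite size_rcons IH.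
have WE n k : (k < n)%N -> (W n)`_k = (W k.+1)`_k.
  elim: n => // n IH; rewrite ltnS leq_eqVlt => /predU1P[-> //|kn].
  by rewrite -IH //= nth_rcons sW kn.
exists (fun n => (W n.+1)`_n) => n; rewrite /= nth_rcons sW ltnn eqxx.
by apply: stepE => i /WE.
Qed.

Lemma fps_unitE f : (f \is a GRing.unit) = (f 0%N \is a GRing.unit).
Proof.
apply/idP/idP => [fU|f0U].
  have := mulVr fU; move/(congr1 (fun f : fps R => f 0%N)).
  by rewrite fps_coef0M fps_coef1 => /= h; apply/unitrPr; exists (f^-1 0%N); rewrite mulrC.
have [|u uE] := @fps_rec (fun n u =>
    ((n == 0%N)%:R - \sum_(i < n) u i * f (n - i)%N) / f 0%N).
  by move=> n u v uv; congr ((_ - _) / _); apply: eq_bigr => i _; rewrite uv.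
apply/unitrPr; exists (Fps u); rewrite mulrC; apply: fpsP => n.
rewrite fps_coefM fps_coef1 big_ord_recr /= subnn [u n in LHS]uE.
by rewrite divrK // addrC subrK.
Qed.

Lemma fps_sqrtP f : 2%:R \is a @GRing.unit R -> f 0%N = 1 ->
  fps_sqrt f 0%N = 1 /\ fps_sqrt f ^+ 2 = f.
Proof.
move=> U2 f0; rewrite /fps_sqrt; case: xgetP => [//|none]; exfalso.
have [|u uE] := @fps_rec (fun n u => if n is k.+1 then
    (f n - \sum_(i < k) u i.+1 * u (n - i.+1)%N) / 2%:R else 1).
  move=> [//|n] u v uv; congr ((_ - _) / _); apply: eq_bigr => i _.
  by rewrite !uv ?ltnS ?leq_subr ?ltn_subrL ?ltn_ord // subSS leq_subr.
apply: (none (Fps u)); split; first by rewrite /= uE.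
apply: fpsP => -[|n]; first by rewrite expr2 fps_coef0M /= uE f0 mulr1.
rewrite expr2 fps_coefM big_ord_recl big_ord_recr /= /bump !add1n subnn subn0.
rewrite [u 0%N]uE mul1r mulr1 [X in _ + (X + _)](_ : _ =
  \sum_(i < n) u i.+1 * u (n.+1 - i.+1)%N) //.
by rewrite addrCA addrC -mulr2n -mulr_natr [u n.+1]uE divrK // subrK.
Qed.

Lemma fps_sqrt_unique f g : 2%:R \is a @GRing.unit R ->
  g 0%N = 1 -> g ^+ 2 = f -> fps_sqrt f = g.
Proof.
move=> U2 g0 gf; have f0 : f 0%N = 1.
  by rewrite -gf expr2 fps_coef0M g0 mulr1.
have [s0 sf] := fps_sqrtP U2 f0; set s := fps_sqrt f in s0 sf *.
have sgU : s + g \is a GRing.unit by rewrite fps_unitE fps_coefD s0 g0.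
apply/eqP; rewrite -subr_eq0; apply/eqP; apply: (mulIr sgU).
by rewrite -subr_sqr sf gf subrr mul0r.
Qed.

End FpsUnitSqrt.

Record laurent (R : nmodType) := Laurent {
  lcoef :> int -> R;
  lcoef_fin : finite_set [set k | lcoef k <> 0] }.

Section LaurentRing.
Variable R : comNzRingType.
Implicit Types f g h : laurent R.

Lemma laurentP f g : f =1 g -> f = g.
Proof.
case: f g => [f fF] [g gF] /= /funext e; case: _ / e in gF *.
by congr Laurent; exact: Prop_irrelevance.
Qed.

HB.instance Definition _ := gen_eqMixin (laurent R).
HB.instance Definition _ := gen_choiceMixin (laurent R).

Fact lmonom_fin (c : R) (m : int) :
  finite_set [set k | (if k == m then c else 0) <> 0].
Proof.
apply: (@sub_finite_set _ _ [set m]); last exact: finite_set1.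
by move=> k /=; case: eqP.
Qed.
Definition lmonom c m := Laurent (lmonom_fin c m).

Definition laurentX : laurent R := lmonom 1 1.

Fact ladd_fin f g : finite_set [set k | f k + g k <> 0].
Proof.
apply: (@sub_finite_set _ _ ([set k | f k <> 0] `|` [set k | g k <> 0])).
  move=> k /= nz; have [f0|/eqP] := eqVneq (f k) 0; last by left.
  by right => g0; apply: nz; rewrite f0 g0 addr0.
by rewrite finite_setU; split; exact: lcoef_fin.
Qed.
Definition ladd f g := Laurent (ladd_fin f g).

Fact lopp_fin f : finite_set [set k | - f k <> 0].
Proof.
apply: sub_finite_set (lcoef_fin f) => k /= nz f0.
by apply: nz; rewrite f0 oppr0.
Qed.
Definition lopp f := Laurent (lopp_fin f).

Let conv (f g : int -> R) (k : int) := \sum_(i \in [set: int]) f i * g (k - i).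

Let convE f (g : int -> R) k :
  conv f g k = \sum_(i <- fset_set [set k | f k <> 0]) f i * g (k - i).
Proof.
rewrite /conv -(fsbig_widen [set k | f k <> 0]) //; last first.
  by move=> i [_ /= /contrapT ->]; rewrite mul0r.
by rewrite fsbig_finite //; exact: lcoef_fin.
Qed.

Fact lmul_fin f g :
  finite_set [set k | \sum_(i \in [set: int]) f i * g (k - i) <> 0].
Proof.
pose S := [set i + j | i in [set i | f i <> 0] & j in [set j | g j <> 0]].
apply: (@sub_finite_set _ _ S); last first.
  by apply: finite_image2; exact: lcoef_fin.
move=> k /= nz; apply: contrapT => NS; apply: nz.
apply: fsbig1 => i _; have [->|/eqP fi] := eqVneq (f i) 0; first by rewrite mul0r.
have [->|/eqP gi] := eqVneq (g (k - i)) 0; first by rewrite mulr0.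
by case: NS; exists i => //; exists (k - i) => //; rewrite addrC subrK.
Qed.
Definition lmul f g := Laurent (lmul_fin f g).

Fact laddA : associative ladd.
Proof. by move=> f g h; apply: laurentP => n /=; rewrite addrA. Qed.
Fact laddC : commutative ladd.
Proof. by move=> f g; apply: laurentP => n /=; rewrite addrC. Qed.
Fact ladd0 : left_id (lmonom 0 0) ladd.
Proof. by move=> f; apply: laurentP => n /=; rewrite if_same add0r. Qed.
Fact laddN : left_inverse (lmonom 0 0) lopp ladd.
Proof. by move=> f; apply: laurentP => n /=; rewrite if_same addNr. Qed.

HB.instance Definition _ := GRing.isZmodule.Build (laurent R)
  laddA laddC ladd0 laddN.

Fact lmulC : commutative lmul.
Proof.
move=> f g; apply: laurentP => k /=.
rewrite (reindex_fsbigT (fun i : int => k - i)) /=.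
  by apply: eq_fsbigr => i _; rewrite subKr mulrC.
by exists (fun i => k - i) => i; rewrite subKr.
Qed.

Fact lmulA : associative lmul.
Proof.
move=> f g h; apply: laurentP => k.
rewrite [in RHS]lmulC [LHS](convE f) [RHS](convE h).
under eq_bigr => i _ do rewrite lmulC [lmul _ _ _](convE h) mulr_sumr.
under [RHS]eq_bigr => i _ do rewrite [lmul _ _ _](convE f) mulr_sumr.
rewrite exchange_big /=; apply: eq_bigr => i _; apply: eq_bigr => j _.
by rewrite mulrCA addrAC.
Qed.

Fact lmul1 : left_id (lmonom 1 0) lmul.
Proof.
move=> f; apply: laurentP => k /=.
rewrite -(fsbig_widen [set 0]) //=; last first.
  by move=> i [_ /= /eqP/negPf ->]; rewrite mul0r.
by rewrite fsbig_set1 eqxx mul1r subr0.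
Qed.

Fact lmulDl : left_distributive lmul ladd.
Proof.
move=> f g h; rewrite ![lmul _ h]lmulC; apply: laurentP => k.
rewrite [LHS](convE h) [RHS](congr2 +%R (convE h _ _) (convE h _ _)).
by rewrite -big_split /=; apply: eq_bigr => i _; rewrite mulrDr.
Qed.

Fact l1neq0 : lmonom 1 0 != 0.
Proof.
apply/eqP => /(congr1 (fun f : laurent R => f 0)) /= /eqP.
by rewrite oner_eq0.
Qed.

HB.instance Definition _ := GRing.Zmodule_isComNzRing.Build (laurent R)
  lmulA lmulC lmul1 lmulDl l1neq0.

Definition laurent_unit : {pred laurent R} := fun f => `[< exists g, g * f = 1 >].
Definition laurent_inv f : laurent R := xget f [set g | g * f = 1].

Fact laurent_mulVx : {in laurent_unit, left_inverse 1 laurent_inv *%R}.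
Proof.
by move=> f /asboolP[g fg]; rewrite /laurent_inv; case: xgetP => [//|/(_ g) []].
Qed.
Fact laurent_unitPl f g : g * f = 1 -> laurent_unit f.
Proof. by move=> gf; apply/asboolP; exists g. Qed.
Fact laurent_inv_out : {in [predC laurent_unit], laurent_inv =1 id}.
Proof.
move=> f /asboolP Nf; rewrite /laurent_inv; case: xgetP => // g _ gf.
by case: Nf; exists g.
Qed.

HB.instance Definition _ := GRing.ComNzRing_hasMulInverse.Build (laurent R)
  laurent_mulVx laurent_unitPl laurent_inv_out.

Lemma laurent_coefM f g k :
  (f * g) k = \sum_(i \in [set: int]) f i * g (k - i).
Proof. by []. Qed.

Lemma lmonomM a b m n : lmonom a m * lmonom b n = lmonom (a * b) (m + n).
Proof.
apply: laurentP => k /=.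
rewrite -(fsbig_widen [set m]) //=; last first.
  by move=> i [_ /= /eqP/negPf ->]; rewrite mul0r.
by rewrite fsbig_set1 eqxx subr_eq [n + m]addrC; case: ifP; rewrite ?mulr0.
Qed.

Lemma laurentX_unit : laurentX \is a GRing.unit.
Proof. by apply/unitrPr; exists (lmonom 1 (-1)); rewrite lmonomM mulr1 subrr. Qed.

Lemma laurentXE (m : int) : laurentX ^ m = lmonom 1 m.
Proof.
have XnE n : laurentX ^+ n = lmonom 1 n%:Z.
  elim: n => [|n IH]; first by rewrite expr0.
  by rewrite exprS IH lmonomM mulr1 -PoszD add1n.
case: m => n; first by rewrite -exprnP XnE.
apply: (mulrI (unitrX n.+1 laurentX_unit)).
by rewrite NegzE -exprnN divrr ?unitrX ?laurentX_unit // XnE lmonomM mulr1 subrr.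
Qed.

End LaurentRing.

Arguments laurentX {R}.

Definition step := (int * int)%type.

Definition SM : seq step := [:: (1, 0); (1, 1); (1, -1)].
Definition vertical_steps : seq step := [:: (0, 1); (0, -1)].
Definition SMW : seq step := SM ++ vertical_steps.

Definition terminus (p : seq step) : step := \sum_(s <- p) s.

Definition vertically_constrained (p : seq step) : bool :=
  all (mem SMW) p &&
  sorted (fun s t => ~~ ((s \in vertical_steps) && (t \in vertical_steps))) p.

Definition AH_paths (n : nat) (m : int) : set (seq step) :=
  [set p | vertically_constrained p /\ terminus p = (n%:Z, m)].

Definition AHR_paths (n : nat) (m : int) : set (seq step) :=
  [set p | AH_paths n m p /\ (if p is s :: _ then s \in SM else true)].

(* These sets are finite, see AH_paths_fin and AHR_paths_fin. *)
Definition AH (n : nat) (m : int) : nat := #|` fset_set (AH_paths n m)|.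
Definition AHR (n : nat) (m : int) : nat := #|` fset_set (AHR_paths n m)|.

Definition words (k : nat) : seq (seq step) :=
  iter k (fun W => [::] :: [seq s :: w | s <- SMW, w <- W]) [:: [::]].

Lemma wordsP k p : (size p <= k)%N -> all (mem SMW) p -> p \in words k.
Proof.
elim: k p => [|k IH] [|s p] // sp /andP[sS pS].
suff: s :: p \in [seq s :: w | s <- SMW, w <- words k].
  by move=> h; apply/orP; right.
by apply: allpairs_f => //; exact: IH.
Qed.

Lemma terminus_cons s p : terminus (s :: p) = s + terminus p.
Proof. by rewrite /terminus big_cons. Qed.

Lemma size_path p : vertically_constrained p ->
  ((size p)%:Z <= (terminus p).1 * 2 + (head (1, 0) p \in vertical_steps)%:Z)%R.
Proof.
move=> /andP[]; elim: p => [|s p IH] /=; first by rewrite /terminus big_nil.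
move=> /andP[sS pS] spV; have {}IH := IH pS (path_sorted spV).
have pV : s \in vertical_steps -> head (1, 0) p \in vertical_steps = false.
  by case: p spV {IH pS} => //= t p /andP[+ _] sV; rewrite sV => /negPf.
rewrite terminus_cons [(s + _).1]/=; set t := (terminus p).1 in IH *.
have [sV|sV] := boolP (s \in vertical_steps).
  rewrite (pV sV) in IH; suff -> : s.1 = 0 by lia.
  by move: sV; rewrite !inE => /orP[] /eqP ->.
suff -> : s.1 = 1 by move: IH; case: (head _ _ \in _); lia.
move: sS; rewrite mem_cat (negPf sV) orbF !inE.
by move=> /orP[/eqP->|/orP[]/eqP->].
Qed.

Lemma AH_paths_words n m p : AH_paths n m p -> p \in words n.*2.+1.
Proof.
move=> [pV pE]; apply: wordsP; last by case/andP: pV.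
have := size_path pV; rewrite pE [_.1]/= -muln2; move: (size p) => k.
by case: (head _ _ \in _); rewrite ?[_%:Z]/=; lia.
Qed.

Lemma AH_paths_fin n m : finite_set (AH_paths n m).
Proof.
apply: (@sub_finite_set _ _ [set` words n.*2.+1]); last exact: finite_seq.
exact: AH_paths_words.
Qed.

Lemma AHR_paths_fin n m : finite_set (AHR_paths n m).
Proof. by apply: sub_finite_set (AH_paths_fin n m) => p []. Qed.

(* a fsbig sum over an infinite support would be 0 by convention *)
Lemma AH_supp_fin n : finite_set [set m | AH n m != 0%N].
Proof.
apply: (@sub_finite_set _ _ [set` [seq (terminus p).2 | p <- words n.*2.+1]]);
  last exact: finite_seq.
move=> m /=; rewrite /AH cardfs_eq0 => /fset0Pn[p].
rewrite in_fset_set ?inE; last exact: AH_paths_fin.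
move=> pP; have [_ pE] := pP.
suff : m \in [seq (terminus p).2 | p <- words n.*2.+1] by [].
by apply/mapP; exists p; rewrite ?pE //; exact: AH_paths_words pP.
Qed.

Lemma AHR_supp_fin n : finite_set [set m | AHR n m != 0%N].
Proof.
apply: sub_finite_set (AH_supp_fin n) => m /=.
rewrite /AHR /AH !cardfs_eq0 => /fset0Pn[p].
rewrite in_fset_set ?inE; last exact: AHR_paths_fin.
move=> [pP _]; apply/fset0Pn; exists p.
by rewrite in_fset_set ?inE //; exact: AH_paths_fin.
Qed.

Lemma denom_unit (R : comNzRingType) (h : fps (laurent R)) :
  fpsC laurentX ^+ 2 - fpsX * h \is a GRing.unit.
Proof.
rewrite fps_unitE fps_coefD fps_coefN fps_coefXM subr0 expr2 fps_coef0M.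
by rewrite unitrM laurentX_unit.
Qed.

Lemma fps_half_coef (f : fps rat) n : (f / 2) n = f n / 2.
Proof.
have U2 : (2 : fps rat) \is a GRing.unit by rewrite fps_unitE.
rewrite -[in RHS](divrK U2 f) mulr_natr mulr2n fps_coefD.
by set a := (f / 2) n; lra.
Qed.

Section Radicands.

Let x : fps rat := fpsX.
Let P : fps rat := fps_sqrt (1 - 10 * x + 9 * x ^+ 2).

Let radicandE : 1 - 10 * x + 9 * x ^+ 2 = 1 + x * (9 * x - 10).
Proof. by ring. Qed.

Lemma P_spec : P 0%N = 1 /\ P ^+ 2 = 1 - 10 * x + 9 * x ^+ 2.
Proof.
by apply: fps_sqrtP => //; rewrite radicandE fps_coefD fps_coefXM addr0.
Qed.

Lemma P_unit : P \is a GRing.unit.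
Proof. by rewrite fps_unitE; have [-> _] := P_spec. Qed.

Let P1 : P 1%N = -5.
Proof.
have [P0] := P_spec; rewrite radicandE.
move=> /(congr1 (fun f : fps rat => f 1%N)).
rewrite fps_coefD fps_coefXM fps_coefD [9 * x]mulrC fps_coefXM add0r.
rewrite expr2 fps_coefM 2!big_ord_recl big_ord0 [X in X -> _]/= P0.
by rewrite subn0 [bump 0 0]/=; lra.
Qed.

Let x3E n : (1 - 3 * x) n = (n == 0%N)%:R - 3 * (n == 1%N)%:R.
Proof.
rewrite fps_coefD fps_coefN fps_coef1 mulr_natl !mulrSr mulr0n !fps_coefD.
by rewrite fps_coef0 /=; ring.
Qed.

Lemma radicand_plus : ((1 - 3 * x + P) / 2) 0%N = 1.
Proof. by rewrite fps_half_coef fps_coefD x3E (proj1 P_spec). Qed.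

Lemma radicand_minus :
  ((1 - 3 * x - P) / 2) 0%N = 0 /\ fps_divX ((1 - 3 * x - P) / 2) 0%N = 1.
Proof.
have E n : ((1 - 3 * x - P) / 2) n
    = ((n == 0%N)%:R - 3 * (n == 1%N)%:R - P n) / 2.
  by rewrite fps_half_coef fps_coefD fps_coefN x3E.
have -> : fps_divX ((1 - 3 * x - P) / 2) 0%N = ((1 - 3 * x - P) / 2) 1%N by [].
by rewrite !E P1 (proj1 P_spec).
Qed.

End Radicands.

(* Main.v *)
(** Cutting a constrained path before each step of [SM] shows that, with
    [T = y^-1 + 1 + y], the coefficient of [x^n] is [T^(2n)] for the paths whose
    first step is in [SM] and [T^(2n+1)] for all paths, so both bivariate series
    are geometric.  The entries [m = 0] are then the central trinomial numbers
    of even and odd index.  Their three-term recurrence (from comparing the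
    derivative of [T^(k+1)] with [(k+1) T^k T']) is a linear differential system
    for the two series [E] and [O].  It has the first integrals that express
    [(E(t^2) + t O(t^2))^2 (1 - 2t - 3t^2) = 1]; solving them for [E^2] and [O^2]
    gives the closed forms. *)
Require Import Defs.
From HB Require Import structures.
From mathcomp Require Import all_boot all_order all_algebra finmap.
From mathcomp Require Import all_classical zify ring lra.

Set Implicit Arguments.
Unset Strict Implicit.
Unset Printing Implicit Defensive.

Import Order.TTheory GRing.Theory Num.Theory.

Local Open Scope classical_set_scope.
Local Open Scope ring_scope.

(** * Coefficients of the powers of [y^-1 + 1 + y], and the recurrence of the central ones *)

Fixpoint trinomial (k : nat) (m : int) : nat :=
  if k is j.+1 then
    (trinomial j (m - 1) + trinomial j m + trinomial j (m + 1))%N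
  else m == 0.

Lemma trinomialS k m : trinomial k.+1 m =
  (trinomial k (m - 1) + trinomial k m + trinomial k (m + 1))%N.
Proof. by []. Qed.

Lemma trinomialN k (m : int) : trinomial k (- m) = trinomial k m.
Proof.
elim: k m => [|k IH] m; first by rewrite /= oppr_eq0.
have -> : trinomial k.+1 (- m) = (trinomial k (- (m + 1)) + trinomial k (- m)
    + trinomial k (- (m - 1)))%N by rewrite opprD opprB [1 - m]addrC.
by rewrite !IH trinomialS addnC addnA addnAC.
Qed.

(** With [T = y^-1 + 1 + y], this compares coefficients of [y^m] in
    [y d/dy T^(k+1) = (k+1) T^k (y - y^-1)]. *)
Lemma trinomial_deriv k (m : int) : m * (trinomial k.+1 m)%:Z =
  k.+1%:Z * ((trinomial k (m - 1))%:Z - (trinomial k (m + 1))%:Z).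
Proof.
elim: k m => [|k IH] m; first by rewrite /=; lia.
rewrite [trinomial k.+2 m]trinomialS 2!PoszD.
transitivity ((m - 1) * (trinomial k.+1 (m - 1))%:Z + m * (trinomial k.+1 m)%:Z
  + (m + 1) * (trinomial k.+1 (m + 1))%:Z
  + ((trinomial k.+1 (m - 1))%:Z - (trinomial k.+1 (m + 1))%:Z)).
  by ring.
by rewrite !IH !trinomialS !PoszD subrK addrK -[k.+2]addn1 PoszD; ring.
Qed.

Lemma central_trinomial_rec k :
  ((k + 2) * trinomial k.+2 0 =
   (2 * k + 3) * trinomial k.+1 0 + 3 * (k + 1) * trinomial k 0)%N.
Proof.
have rec0 j : trinomial j.+1 0 = (2 * trinomial j 1 + trinomial j 0)%N.
  by rewrite trinomialS sub0r trinomialN add0r mul2n -addnn addnAC.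
rewrite [trinomial k.+2 0]rec0 !rec0.
(* By symmetry only the entries of row [k] at 0, 1 and 2 are left; the derivative identity at
   [m = 1] is the linear relation that eliminates the one at 2. *)
have := trinomial_deriv k 1; rewrite trinomialS subrr.
move: (trinomial k 0) (trinomial k 1) (trinomial k (1 + 1)) => a b c; nia.
Qed.

Lemma central_trinomial_recr (R : comNzRingType) k :
  (k%:R + 2) * (trinomial k.+2 0)%:R =
  (2 * k%:R + 3) * (trinomial k.+1 0)%:R
  + 3 * (k%:R + 1) * (trinomial k 0)%:R :> R.
Proof.
move: (trinomial k.+2 0) (trinomial k.+1 0) (trinomial k 0)
  (central_trinomial_rec k) => a b c e.
by have := congr1 (fun n => n%:R : R) e; rewrite /= !(natrD, natrM).
Qed.

(** * Counting constrained paths by their first step *)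

Lemma finite_card_setU (T : choiceType) (A B : set T) :
  finite_set A -> finite_set B -> A `&` B = set0 ->
  #|` fset_set (A `|` B)| = (#|` fset_set A| + #|` fset_set B|)%N.
Proof.
move=> fA fB AB0; rewrite fset_setU // cardfsU -fset_setI // AB0 fset_set0.
by rewrite cardfs0 subn0.
Qed.

Lemma card_cons (T : choiceType) (x : T) (A : set (seq T)) : finite_set A ->
  #|` fset_set (cons x @` A)| = #|` fset_set A|.
Proof. by move=> fA; rewrite fset_set_image // card_imfset // => p q []. Qed.

Lemma card_cons3 (T : choiceType) (a b c : T) (A B C : set (seq T)) :
  a != b -> a != c -> b != c -> finite_set A -> finite_set B -> finite_set C ->
  #|` fset_set (cons a @` A `|` cons b @` B `|` cons c @` C)| =
  (#|` fset_set A| + #|` fset_set B| + #|` fset_set C|)%N.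
Proof.
move=> /eqP ab /eqP ac /eqP bc fA fB fC.
rewrite !finite_card_setU ?card_cons // ?finite_setU; try exact: finite_image.
- by apply/disjoints_subset => _ [p _ <-] [q _ []] /esym.
- by split; exact: finite_image.
- by apply/disjoints_subset => _ [] [p _ <-] [q _ []] /esym.
Qed.

Lemma card_setU_cons2 (T : choiceType) (a b : T) (A B C : set (seq T)) :
  a != b -> (forall p, A p -> ohead p != Some a /\ ohead p != Some b) ->
  finite_set A -> finite_set B -> finite_set C ->
  #|` fset_set (A `|` cons a @` B `|` cons b @` C)| =
  (#|` fset_set A| + #|` fset_set B| + #|` fset_set C|)%N.
Proof.
move=> /eqP ab Aab fA fB fC.
rewrite !finite_card_setU ?card_cons // ?finite_setU; try exact: finite_image.
- by apply/disjoints_subset => _ /[swap] -[p _ <-] /Aab[]; rewrite eqxx.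
- by split=> //; exact: finite_image.
- apply/disjoints_subset => q + [p _ pq]; rewrite -{}pq.
  by case=> [/Aab[_]|[r _ []]] //; rewrite eqxx.
Qed.

Lemma vertically_constrained_SM (s : step) p : s \in SM ->
  vertically_constrained (s :: p) = vertically_constrained p.
Proof.
move=> sM; rewrite /vertically_constrained /= [s \in SMW]mem_cat sM /=.
have sV : (s \in vertical_steps) = false.
  by move: sM; rewrite !inE => /or3P[] /eqP ->.
by case: p => //= t p; rewrite sV.
Qed.

Lemma vertically_constrained_vertical (s : step) p : s \in vertical_steps ->
  vertically_constrained (s :: p) =
  vertically_constrained p && (if p is t :: _ then t \in SM else true).
Proof.
move=> sV; rewrite /vertically_constrained /= [s \in SMW]mem_cat sV orbT /=.
case: p => //= t p; rewrite sV /= [t \in SMW]mem_cat.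
have : (t \in SM) ==> (t \notin vertical_steps).
  by apply/implyP; rewrite !inE => /or3P[] /eqP ->.
by case: (t \in SM); case: (t \in vertical_steps); rewrite //= ?andbF ?andbT.
Qed.

Lemma AHR_pathsS n m : AHR_paths n.+1 m =
  cons (1, 1) @` AH_paths n (m - 1) `|` cons (1, 0) @` AH_paths n m
  `|` cons (1, -1) @` AH_paths n (m + 1).
Proof.
apply/seteqP; split=> [[|s p] [[]]|].
- by rewrite /terminus big_nil => _ [].
- move=> + + sM; rewrite vertically_constrained_SM // terminus_cons => pV.
  move: sM; rewrite !inE; case pE: (terminus p) => [a b].
  case/or3P => /eqP -> [an bm]; [left; right|left; left|right];
    by exists p => //; split=> //; rewrite pE; congr pair; lia.
- have H s p k : s \in SM -> s.1 = 1 -> AH_paths n k p -> s.2 + k = m ->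
      AHR_paths n.+1 m (s :: p).
    move=> sM s1 [pV pE] km; split=> //; split.
      by rewrite vertically_constrained_SM.
    by rewrite terminus_cons pE -km; congr pair; rewrite /= ?s1 //; lia.
  by move=> _ [[]|] [p /H + <-]; apply=> //=; rewrite ?addrK ?subrK; lia.
Qed.

(** After a vertical first step the rest may not begin vertically, which is the extra condition of
    [AHR_paths]. *)
Lemma AH_pathsE n m : AH_paths n m =
  AHR_paths n m `|` cons (0, 1) @` AHR_paths n (m - 1)
  `|` cons (0, -1) @` AHR_paths n (m + 1).
Proof.
apply/seteqP; split=> [[|s p] pA|].
- by left; left.
- have [sM|sM] := boolP (s \in SM); first by left; left.
  have [pV] := pA; rewrite terminus_cons.
  have sV : s \in vertical_steps.
    by move: pV => /andP[/= /andP[+ _] _]; rewrite [_ \in SMW]mem_cat (negPf sM).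
  move: pV; rewrite vertically_constrained_vertical // => /andP[pV pM].
  move: sV; rewrite !inE; case pE: (terminus p) => [a b].
  case/orP => /eqP -> [an bm]; [left; right|right];
    exists p => //; (split; last by case: (p) pM); split=> //;
    by rewrite pE; congr pair; lia.
- have H s p k : s \in vertical_steps -> s.1 = 0 -> AHR_paths n k p ->
      s.2 + k = m -> AH_paths n m (s :: p).
    move=> sV s1 [[pV pE] pM] km; split.
      by rewrite vertically_constrained_vertical // pV; case: (p) pM.
    by rewrite terminus_cons pE -km; congr pair; rewrite /= ?s1 //; lia.
  by move=> p [[[]//|]|] [q /H + <-]; apply=> //=; lia.
Qed.

Lemma AHRS n m : AHR n.+1 m = (AH n (m - 1) + AH n m + AH n (m + 1))%N.
Proof.
by rewrite /AHR AHR_pathsS card_cons3 //; exact: AH_paths_fin.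
Qed.

Lemma AHE n m : AH n m = (AHR n (m - 1) + AHR n m + AHR n (m + 1))%N.
Proof.
rewrite /AH AH_pathsE card_setU_cons2 //; try exact: AHR_paths_fin.
  by rewrite [X in (X + _)%N]addnC.
by case=> [|s p] [_]; rewrite // !inE => /or3P[] /eqP ->.
Qed.

Lemma AHR0 m : AHR 0 m = (m == 0).
Proof.
rewrite /AHR; have -> : AHR_paths 0 m = if m == 0 then [set [::]] else set0.
  apply/seteqP; split=> [[|s p] [[pV pE] pM]|p].
  - by move: pE; rewrite /terminus big_nil => -[<-].
  (* [size_path] bounds a length by twice this coordinate plus at most 1, so the coordinate cannot
     be negative; a first step in [SM] then makes the total positive. *)
  - have p0 : 0 <= (terminus p).1.
      move: pV; rewrite vertically_constrained_SM // => /size_path.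
      by case: (_ \in _); lia.
    move: pE p0; rewrite terminus_cons; case: (terminus p) => a b /=.
    by move: pM; rewrite !inE => /or3P[] /eqP -> [] /=; lia.
  - case: eqP => // -> ->; split=> //; split=> //.
    by rewrite /terminus big_nil.
by case: eqP => _; rewrite ?fset_set1 ?fset_set0 ?cardfs1 ?cardfs0.
Qed.

(** [AHRS] and [AHE] both have the shape of [trinomialS], so raising [n] by one takes two rows. *)
Lemma AHR_trinomial n m : AHR n m = trinomial n.*2 m.
Proof.
elim: n m => [|n IH] m; first exact: AHR0.
by rewrite AHRS !AHE !IH.
Qed.

Lemma AH_trinomial n m : AH n m = trinomial n.*2.+1 m.
Proof. by rewrite AHE !AHR_trinomial. Qed.

(** * The Euler operator and geometric power series *)

Section FpsEuler.
Variable R : comNzRingType.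
Implicit Types f g : fps R.

(** The operator [x d/dx], which unlike [d/dx] keeps coefficients at their index, so that a factor
    [n] in a recurrence becomes [theta]. *)
Definition theta f : fps R := Fps (fun n => n%:R * f n).

Lemma thetaD f g : theta (f + g) = theta f + theta g.
Proof. by apply: fpsP => n; rewrite /= mulrDr. Qed.

Lemma thetaN f : theta (- f) = - theta f.
Proof. by apply: fpsP => n; rewrite /= mulrN. Qed.

Lemma thetaM f g : theta (f * g) = theta f * g + f * theta g.
Proof.
apply: fpsP => n; rewrite fps_coefD [LHS]/= mulr_sumr !fps_coefM -big_split.
apply: eq_bigr => i _ /=; rewrite -{1}(@subnKC i n) -1?ltnS // natrD.
by ring.
Qed.

Lemma theta_nat k : theta k%:R = 0.
Proof.
have t1 : theta 1 = 0 by apply: fpsP => -[|n]; rewrite /= ?mul0r ?mulr0.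
elim: k => [|k IH]; last by rewrite -addn1 natrD thetaD IH t1 addr0.
apply: fpsP => n; rewrite -[LHS]/(n%:R * (0 : fps R) n).
by rewrite fps_coef0 mulr0.
Qed.

Lemma thetaX : theta fpsX = fpsX.
Proof. by apply: fpsP => -[|[|n]]; rewrite /= ?mul0r ?mulr1 ?mulr0. Qed.

Lemma fpsC_M (c : R) f n : (fpsC c * f) n = c * f n.
Proof.
rewrite fps_coefM big_ord_recl /= subn0 big1 ?addr0 // => i _.
by rewrite mul0r.
Qed.

Lemma fps_natM k f n : (k%:R * f) n = k%:R * f n.
Proof.
elim: k => [|k IH]; first by rewrite !mul0r fps_coef0.
by rewrite -addn1 !natrD !mulrDl fps_coefD IH !mul1r.
Qed.

Lemma fpsC_is_zmod_morphism : zmod_morphism (@fpsC R).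
Proof. by move=> a b; apply: fpsP => -[|n] /=; rewrite ?subr0. Qed.

Lemma fpsC_is_monoid_morphism : monoid_morphism (@fpsC R).
Proof.
split=> // a b; apply: fpsP => n; rewrite fpsC_M /=.
by case: ifP => // _; rewrite mulr0.
Qed.

HB.instance Definition _ :=
  GRing.isZmodMorphism.Build R (fps R) (@fpsC R) fpsC_is_zmod_morphism.
HB.instance Definition _ :=
  GRing.isMonoidMorphism.Build R (fps R) (@fpsC R) fpsC_is_monoid_morphism.

Lemma fps_geometric (a q : R) :
  Fps (fun n => a * q ^+ n) * (1 - fpsX * fpsC q) = fpsC a.
Proof.
rewrite mulrBr mulr1 mulrCA; apply: fpsP => -[|n].
  by rewrite fps_coefD fps_coefN fps_coefXM subr0 /= mulr1.
rewrite fps_coefD fps_coefN fps_coefXM mulrC fpsC_M /=.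
by rewrite mulrCA -exprS subrr.
Qed.

End FpsEuler.

(** In characteristic zero the factor [n.+1] cancels; this is how first integrals are recognised as
    constants. *)
Lemma theta_eq0 (f : fps rat) : theta f = 0 -> f = fpsC (f 0%N).
Proof.
move=> tf; apply: fpsP => -[//|n] /=; apply/eqP.
have /eqP := congr1 (fun g : fps rat => g n.+1) tf.
by rewrite /= mulf_eq0 pnatr_eq0.
Qed.

(** * Laurent polynomials and the powers of [T] *)

Section Laurent.
Variable R : comNzRingType.
Implicit Types f : laurent R.

Lemma lmonom_M (c : R) m f k : (lmonom c m * f) k = c * f (k - m).
Proof.
rewrite laurent_coefM -(fsbig_widen [set m]) //=; last first.
  by move=> i [_ /= /eqP/negPf ->]; rewrite mul0r.
by rewrite fsbig_set1 eqxx.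
Qed.

Lemma laurent_coef_sum (I : Type) (s : seq I) (F : I -> laurent R) k :
  (\sum_(i <- s) F i) k = \sum_(i <- s) F i k.
Proof. by elim/big_rec2: _ => /= [|i a b _ <-]; rewrite ?if_same. Qed.

(** The sum over all integers is a genuine one because the support of [f] is finite. *)
Lemma laurent_monomE f : \sum_(m \in [set: int]) lmonom (f m) m = f.
Proof.
rewrite -(fsbig_widen [set k | f k <> 0]) //; last first.
  move=> i [_ /= /contrapT ->]; apply: laurentP => k /=.
  by rewrite !if_same.
rewrite fsbig_finite /=; last exact: lcoef_fin.
apply: laurentP => k; rewrite laurent_coef_sum /=.
have [fk|fk] := eqVneq (f k) 0.
  by rewrite big1_seq ?fk // => i _; case: eqP => // <-.
rewrite (big_fsetD1 k) /=; last first.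
  rewrite in_fset_set ?inE /=; first exact/eqP.
  exact: lcoef_fin.
rewrite eqxx big1_fset ?addr0 // => i; rewrite !inE => /andP[ik _] _.
by rewrite eq_sym (negPf ik).
Qed.

Lemma laurent_natM k f m : (k%:R * f) m = k%:R * f m.
Proof.
elim: k => [|k IH]; first by rewrite !mul0r /= if_same.
by rewrite -addn1 !natrD !mulrDl -IH !mul1r.
Qed.

End Laurent.

Definition step_laurent : laurent rat := lmonom 1 (-1) + 1 + lmonom 1 1.

Lemma step_laurentX k m : (step_laurent ^+ k) m = (trinomial k m)%:R.
Proof.
elim: k m => [|k IH] m; first by rewrite expr0 /=; case: eqP.
have coefD (f g : laurent rat) : (f + g) m = f m + g m by [].
rewrite exprS /step_laurent !mulrDl mul1r !coefD !lmonom_M !mul1r opprK !IH.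
by rewrite trinomialS !natrD addrC addrA addrAC.
Qed.

Lemma sum_trinomial k :
  \sum_(m \in [set: int]) (trinomial k m)%:R * (laurentX : laurent rat) ^ m =
  step_laurent ^+ k.
Proof.
rewrite -[RHS]laurent_monomE; apply: eq_fsbigr => m _.
rewrite laurentXE step_laurentX; apply: laurentP => j.
by rewrite laurent_natM /=; case: ifP; rewrite ?mulr1 ?mulr0.
Qed.

Lemma laurentX_step :
  laurentX * step_laurent = 1 + laurentX + laurentX ^+ 2 :> laurent rat.
Proof.
by rewrite /step_laurent !mulrDr mulr1 -expr2 lmonomM mulr1 subrr.
Qed.

(** Since [1 + y + y^2 = y T], the denominator is [y^2] times that of a geometric series of ratio
    [x T^2]. *)
Lemma denominatorE :
  let y : fps (laurent rat) := fpsC laurentX in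
  y ^+ 2 - fpsX * (1 + y + y ^+ 2) ^+ 2 =
  y ^+ 2 * (1 - fpsX * fpsC (step_laurent ^+ 2)).
Proof.
move=> y; have -> : 1 + y + y ^+ 2 = y * fpsC step_laurent.
  by rewrite /y -rmorphM laurentX_step !rmorphD rmorph1 rmorphXn.
by rewrite rmorphXn; ring.
Qed.

(** * Solving the differential system for the even and odd series *)

Section EvenOdd.
Variables E O : fps rat.
Let x : fps rat := fpsX.
Let D : fps rat := 1 - 10 * x + 9 * x ^+ 2.
Let P : fps rat := fps_sqrt D.

Hypothesis E0 : E 0%N = 1.
(** Coefficientwise, [eqE] and [eqO] are the central trinomial recurrence at [k = 2n] and
    [k = 2n + 1]. *)
Hypothesis eqE : 2 * theta E =
  x * (4 * theta O + 3 * O) + 3 * x * (2 * theta E + E).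
Hypothesis eqO : 2 * theta O + O =
  4 * theta E + E + 6 * x * (theta O + O).

Let U2 : (2 : fps rat) \is a GRing.unit.
Proof. by rewrite fps_unitE. Qed.

Let D0 : D 0%N = 1.
Proof.
rewrite (_ : D = 1 + x * (9 * x - 10)); last by rewrite /D; ring.
by rewrite fps_coefD fps_coefXM addr0.
Qed.

Let DU : D \is a GRing.unit.
Proof. by rewrite fps_unitE D0. Qed.

Let U4 : (4 : fps rat) \is a GRing.unit.
Proof. by rewrite fps_unitE. Qed.

Let thetaE_part : (2 - 6 * x) * theta E - 4 * x * theta O = 3 * x * (O + E).
Proof.
by have /eqP := eqE; rewrite -subr_eq0 => /eqP e; rewrite -[RHS]addr0 -e; ring.
Qed.

Let thetaO_part : (2 - 6 * x) * theta O - 4 * theta E = E - O + 6 * x * O.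
Proof.
by have /eqP := eqO; rewrite -subr_eq0 => /eqP e; rewrite -[RHS]addr0 -e; ring.
Qed.

(** Cramer's rule, here and in [D_O]: the system has determinant [(2 - 6x)^2 - 16x = 4D]. *)
Let D_E : 4 * D * theta E =
  6 * x * (1 - 3 * x) * (O + E) + 4 * x * (E - O + 6 * x * O).
Proof.
transitivity ((2 - 6 * x) * ((2 - 6 * x) * theta E - 4 * x * theta O)
  + 4 * x * ((2 - 6 * x) * theta O - 4 * theta E)); first by rewrite /D; ring.
by rewrite thetaE_part thetaO_part; ring.
Qed.

Let D_O : 4 * D * theta O =
  12 * x * (O + E) + (2 - 6 * x) * (E - O + 6 * x * O).
Proof.
transitivity (4 * ((2 - 6 * x) * theta E - 4 * x * theta O)
  + (2 - 6 * x) * ((2 - 6 * x) * theta O - 4 * theta E)).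
  by rewrite /D; ring.
by rewrite thetaE_part thetaO_part; ring.
Qed.

Let thetaE := (thetaD, thetaN, thetaM, theta_nat, @theta_nat rat 1,
  @thetaX rat : theta x = x).

Let D4U : 4 * D \is a GRing.unit.
Proof. by rewrite unitrM U4. Qed.

(* [even_part] and [odd_part] are the even and odd parts in [t] of
   [(E(t^2) + t O(t^2))^2 (1 - 2t - 3t^2) = 1], with [x = t^2]. *)
Let even_part : (E ^+ 2 + x * O ^+ 2) * (1 - 3 * x) - 4 * x * E * O = 1.
Proof.
set I := LHS; have tI : theta I = 0.
  apply: (mulrI D4U).
  (* The product rule, grouped so that [D_E] and [D_O] eliminate the derivatives. *)
  transitivity ((4 * D * theta E) * (2 * E * (1 - 3 * x) - 4 * x * O)
    + (4 * D * theta O) * (2 * x * O * (1 - 3 * x) - 4 * x * E)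
    + 4 * D * (x * O ^+ 2 * (1 - 3 * x) - 3 * x * (E ^+ 2 + x * O ^+ 2)
               - 4 * x * E * O)).
    rewrite /I !expr2 !thetaE; ring.
  by rewrite D_E D_O /D; ring.
rewrite (theta_eq0 tI) (_ : I = E ^+ 2 + x * (O ^+ 2 * (1 - 3 * x)
  - 3 * E ^+ 2 - 4 * E * O)); last by rewrite /I; ring.
by rewrite fps_coefD fps_coefXM addr0 expr2 fps_coef0M E0 mulr1.
Qed.

Let odd_part : E * O * (1 - 3 * x) = E ^+ 2 + x * O ^+ 2.
Proof.
apply/eqP; rewrite -subr_eq0; set I := _ - _.
(* The odd part is [t I(t^2)] up to a factor 2, and [t d/dt] acts on it as [2 theta + 1]. This
   operator multiplies coefficient [n] by [2n + 1], so its kernel is zero. *)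
have tI : 2 * theta I + I = 0.
  apply: (mulrI D4U).
  transitivity ((4 * D * theta E) * (2 * (O * (1 - 3 * x) - 2 * E))
    + (4 * D * theta O) * (2 * (E * (1 - 3 * x) - 2 * x * O))
    + 4 * D * (- 6 * x * E * O - 2 * x * O ^+ 2 + I)).
    rewrite /I !expr2 !thetaE; ring.
  by rewrite D_E D_O /I /D; ring.
apply/eqP/fpsP => n; rewrite fps_coef0.
have := congr1 (fun f : fps rat => f n) tI.
rewrite fps_coefD fps_natM fps_coef0 /= => /eqP.
rewrite -[X in _ + X]mul1r mulrA -mulrDl mulf_eq0 => /orP[|/eqP//].
by rewrite -natrM -(natrD _ _ 1) addn1 pnatr_eq0.
Qed.

Let P0 : P 0%N = 1 /\ P ^+ 2 = D.
Proof. exact: fps_sqrtP. Qed.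

(** Eliminating [E O] between the two parts leaves the factor [(1 - 3x)^2 - 4x = D]. *)
Let norm_sum : (E ^+ 2 + x * O ^+ 2) * D = 1 - 3 * x.
Proof.
transitivity (((E ^+ 2 + x * O ^+ 2) * (1 - 3 * x) - 4 * x * E * O)
  * (1 - 3 * x)); last by rewrite even_part mul1r.
transitivity ((E ^+ 2 + x * O ^+ 2) * (1 - 3 * x) ^+ 2
   - 4 * x * (E * O * (1 - 3 * x))); last by ring.
by rewrite odd_part /D; ring.
Qed.

(* The left factor is [C(t) C(-t)] for [C(t) = E(t^2) + t O(t^2)]. *)
Let norm_part : (E ^+ 2 - x * O ^+ 2) * P = 1.
Proof.
have [p0 p2] := P0; set W := _ - _.
have W2 : W ^+ 2 * D = 1.
  apply: (mulrI DU); rewrite mulr1.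
  transitivity (((E ^+ 2 + x * O ^+ 2) * D) ^+ 2 - 4 * x * (E * O * D) ^+ 2).
    by rewrite /W; ring.
  (* What remains is again [(1 - 3x)^2 - 4x = D]. *)
  suff -> : E * O * D = 1 by rewrite norm_sum /D; ring.
  have U3 : 1 - 3 * x \is a GRing.unit.
    rewrite fps_unitE mulrC fps_coefD fps_coefN fps_coefXM subr0.
    by rewrite fps_coef1.
  by apply: (mulrI U3); rewrite mulr1 -[RHS]norm_sum -odd_part; ring.
have WP0 : (W * P) 0%N = 1.
  rewrite fps_coef0M p0 mulr1 /W fps_coefD fps_coefN fps_coefXM subr0.
  by rewrite expr2 fps_coef0M E0 mulr1.
have WP2 : (W * P) ^+ 2 = 1 by rewrite exprMn p2 W2.
(* [W P] squares to 1; its constant term 1 excludes the root [-1]. *)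
have sqrt1 : fps_sqrt 1 = 1 :> fps rat.
  by apply: fps_sqrt_unique => //; rewrite expr1n.
by rewrite -sqrt1; apply/esym/fps_sqrt_unique.
Qed.

Let norm_partD : (E ^+ 2 - x * O ^+ 2) * D = P.
Proof. by rewrite -(proj2 P0) expr2 mulrA norm_part mul1r. Qed.

Let PU : P \is a GRing.unit.
Proof. by rewrite fps_unitE (proj1 P0). Qed.

(** Adding [norm_sum] and [norm_partD] gives [2 E^2 D = 1 - 3x + P], and [E^2 D = (E P)^2]. *)
Lemma even_part_closed_form : E = 1 / P * fps_sqrt ((1 - 3 * x + P) / 2).
Proof.
rewrite (@fps_sqrt_unique _ _ (E * P)) //.
- by rewrite mulrCA div1r mulVr ?mulr1.
- by rewrite fps_coef0M E0 (proj1 P0) mulr1.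
apply: (mulIr U2); rewrite divrK // exprMn (proj2 P0).
by rewrite -[in RHS]norm_partD -norm_sum; ring.
Qed.

(** Subtracting instead gives [2 x O^2 D = 1 - 3x - P]; [fps_divX] removes the factor [x]. *)
Lemma odd_part_closed_form :
  O = 1 / P * fps_sqrt (fps_divX ((1 - 3 * x - P) / 2)).
Proof.
(* In degree 0 every [theta] term of [eqO] vanishes, leaving the constant terms of [O] and [E]
   equal. *)
have O0 : O 0%N = 1.
  have := congr1 (fun f : fps rat => f 0%N) eqO.
  rewrite -[6 * x * _]mulrA mulrCA !fps_coefD fps_coefXM !fps_natM addr0.
  by rewrite /= !mul0r !mulr0 !add0r E0.
rewrite (@fps_sqrt_unique _ _ (O * P)) //.
- by rewrite mulrCA div1r mulVr ?mulr1.
- by rewrite fps_coef0M O0 (proj1 P0) mulr1.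
suff -> : (1 - 3 * x - P) / 2 = x * (O * P) ^+ 2.
  apply: fpsP => n; rewrite -[RHS]/((x * (O * P) ^+ 2) n.+1).
  by rewrite fps_coefXM.
apply: (mulIr U2); rewrite divrK // exprMn (proj2 P0).
by rewrite -[in LHS]norm_partD -norm_sum; ring.
Qed.

End EvenOdd.

(** * From the path counts to the four generating functions *)

Theorem theorem9 :
  (let x : fps (laurent rat) := fpsX in
   let y0 : laurent rat := laurentX in
   let y : fps (laurent rat) := fpsC y0 in
   Fps (fun n => \sum_(m \in [set: int]) (AHR n m)%:R * y0 ^ m)
     = y ^+ 2 / (y ^+ 2 - x * (1 + y + y ^+ 2) ^+ 2)
   /\
   Fps (fun n => \sum_(m \in [set: int]) (AH n m)%:R * y0 ^ m)
     = (y * (1 + y + y ^+ 2)) / (y ^+ 2 - x * (1 + y + y ^+ 2) ^+ 2))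
  /\
  (let x : fps rat := fpsX in
   let P : fps rat := fps_sqrt (1 - 10 * x + 9 * x ^+ 2) in
   Fps (fun n => (AHR n 0)%:R)
     = 1 / P * fps_sqrt ((1 - 3 * x + P) / 2)
   /\
   Fps (fun n => (AH n 0)%:R)
     = 1 / P * fps_sqrt (fps_divX ((1 - 3 * x - P) / 2))).
Proof.
split=> [x y0 y|x P].
  have dU := denom_unit ((1 + y + y ^+ 2) ^+ 2).
  split; apply: (mulIr dU); rewrite divrK //.
  - rewrite denominatorE mulrCA
      (_ : Fps _ = Fps (fun n => 1 * (step_laurent ^+ 2) ^+ n)).
      by rewrite fps_geometric mulr1.
    apply: fpsP => n /=; rewrite mul1r -exprM mul2n -sum_trinomial.
    by apply: eq_fsbigr => m _; rewrite AHR_trinomial.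
  - rewrite denominatorE mulrCA
      (_ : Fps _ = Fps (fun n => step_laurent * (step_laurent ^+ 2) ^+ n)).
      (* The first term is [T], and [y^2 T = y (1 + y + y^2)] is the numerator. *)
      rewrite fps_geometric expr2 -mulrA -rmorphM laurentX_step.
      by rewrite !rmorphD rmorph1 rmorphXn.
    apply: fpsP => n /=; rewrite -exprM -exprS mul2n -sum_trinomial.
    by apply: eq_fsbigr => m _; rewrite AH_trinomial.
set E := Fps _; set O := Fps (fun n => (AH n 0)%:R).
have E0 : E 0%N = 1 by rewrite /E /= AHR_trinomial.
have eqE : 2 * theta E =
    x * (4 * theta O + 3 * O) + 3 * x * (2 * theta E + E).
  (* Bringing [x] to the front exposes the shift: degree 0 is trivial, and degree [n.+1] is the
     recurrence at [2n]. *)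
  rewrite -[3 * x * _]mulrA [3 * (x * _)]mulrCA -mulrDr; apply: fpsP => -[|n].
    by rewrite fps_coefXM fps_natM /= mul0r mulr0.
  rewrite fps_coefXM !(fps_coefD, fps_natM) /= !AHR_trinomial !AH_trinomial.
  have := central_trinomial_recr rat n.*2.
  have -> : n.*2%:R = 2 * n%:R :> rat by rewrite -mul2n natrM.
  have -> : n.+1%:R = n%:R + 1 :> rat by rewrite natr1.
  move: (trinomial n.*2.+2 0) (trinomial n.*2.+1 0) (trinomial n.*2 0).
  by move=> a b c; lra.
have eqO : 2 * theta O + O = 4 * theta E + E + 6 * x * (theta O + O).
  (* Here degree 0 compares the two constant terms, both 1, and degree [n.+1] is the recurrence at
     [2n + 1]. *)
  rewrite -[6 * x * _]mulrA [6 * (x * _)]mulrCA; apply: fpsP => -[|n].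
    rewrite !fps_coefD fps_coefXM !fps_natM /= !mul0r !mulr0 !add0r addr0.
    by rewrite AHR_trinomial AH_trinomial.
  rewrite fps_coefD fps_natM !fps_coefD fps_coefXM !(fps_coefD, fps_natM) /=.
  rewrite !AHR_trinomial !AH_trinomial.
  have := central_trinomial_recr rat n.*2.+1.
  have -> : n.*2.+1%:R = 2 * n%:R + 1 :> rat by rewrite -natr1 -mul2n natrM.
  have -> : n.+1%:R = n%:R + 1 :> rat by rewrite natr1.
  move: (trinomial n.*2.+3 0) (trinomial n.*2.+2 0) (trinomial n.*2.+1 0).
  by move=> a b c; lra.
split.
  exact: even_part_closed_form E0 eqE eqO.
exact: odd_part_closed_form E0 eqE eqO.
Qed.
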